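(* Let $\pi\in S_n$ have kernel shape $\rho$. Let $\widetilde G$ be a connected component of $G_\pi$ different from the component containing the entry $n$. Then all entries of $\pi$ that are vertices of $\widetilde G$ lie in one and the same feasible cell of the kernel cell decomposition of $\pi$.
   Context: Patterns. An occurrence of $132$ in $\pi\in S_n$ is a triple of positions $i<j<k$ with $\pi(i)<\pi(k)<\pi(j)$. The graph $G_\pi$. $G_\pi$ is the bipartite graph whose vertices are the entries of $\pi$ and the occurrences of $132$ in $\pi$. An entry is adjacent to an occurrence exactly when it is one of the three entries of that occurrence. Kernel. Let $\pi(i_1),\dots,\pi(i_s)$, with $i_1<\dots<i_s$, be the entries in the component of $G_\pi$ containing $n$. This subsequence is the kernel of $\pi$. The permutation $\rho\in S_s$ order-isomorphic to it is the kernel shape. Kernel cell decomposition. Set $i_0=0$, $i_{s+1}=n+1$, and interpret $\pi(i_{\rho^{-1}(0)})$ as $0$. For $1\leq m\leq s$ and $1\leq l\leq s+1$, define $$C_{ml}(\pi)=\{\pi(j): i_{l-1}<j<i_l,\ \pi(i_{\rho^{-1}(m-1)})<\pi(j)<\pi(i_{\rho^{-1}(m)})\}.$$ Here $\pi(i_{\rho^{-1}(m)})$ is the $m$-th smallest kernel entry. Feasibility. The cell $C_{ml}$ is infeasible if, in the sequence $(\rho(1),\dots,\rho(l-1),m-\tfrac12,\rho(l),\dots,\rho(s))$, the inserted entry $m-\tfrac12$ belongs to some occurrence of $132$. Equivalently, any entry of $\pi$ placed in that cell would form an occurrence of $132$ with two kernel entries. Otherwise the cell is feasible. *)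

(* Defs.v *)
From HB Require Import structures.
From mathcomp Require Import all_boot all_order all_fingroup all_algebra.

Set Implicit Arguments.
Unset Strict Implicit.
Unset Printing Implicit Defensive.

Import Order.TTheory GRing.Theory Num.Theory.

(* Permutations of length n >= 1 are elements of 'S_n with positions and       *)
(* values shifted down by one: i : 'I_n stands for the integer i.+1. The       *)
(* length is written n.+1 where an entry of maximal value has to exist; that   *)
(* entry is then ord_max.                                                      *)

Definition occ132 d (T : porderType d) N (f : 'I_N -> T) (i j k : 'I_N) : bool :=
  [&& (i < j)%N, (j < k)%N, (f i < f k)%O & (f k < f j)%O].

Section PatternGraph.
Variables (n : nat) (p : 'S_n.+1).

(* inl v is the entry with value v (not the entry at position v);              *)
(* inr t is an occurrence, given by its triple of positions.                   *)
Definition vertex : finType :=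
  ('I_n.+1
   + {t : 'I_n.+1 * 'I_n.+1 * 'I_n.+1 | occ132 p t.1.1 t.1.2 t.2})%type.

Definition entry_in (v : 'I_n.+1) (t : 'I_n.+1 * 'I_n.+1 * 'I_n.+1) : bool :=
  v \in [:: p t.1.1; p t.1.2; p t.2].

Definition adj : rel vertex := fun x y =>
  match x, y with
  | inl v, inr t => entry_in v (val t)
  | inr t, inl v => entry_in v (val t)
  | _, _ => false
  end.

(* A component is represented by its vertex set.                               *)
Definition components : {set {set vertex}} :=
  equivalence_partition (connect adj) [set: vertex].

Definition top_component : {set vertex} := pblock components (inl ord_max).

(* The positions of the kernel. As enum 'I_n.+1 is increasing, so is           *)
(* enum kernel_pos, and i_1 < ... < i_s are the positions enum_val a for       *)
(* a = 0, ..., s - 1.                                                          *)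
Definition kernel_pos : {set 'I_n.+1} :=
  [set i | inl (p i) \in top_component].

Definition is_kernel_shape (rho : 'S_#|kernel_pos|) : Prop :=
  forall a b : 'I_#|kernel_pos|,
    (rho a < rho b)%N = (p (enum_val a) < p (enum_val b))%N.

(* The positions i_0 = 0, i_1, ..., i_s, i_(s+1) = n + 1 in the convention     *)
(* that counts from 1; since the length is n.+1 here, the last one is n.+2.    *)
Definition kernel_bound (l : nat) : nat :=
  nth n.+2 (0 :: [seq (nat_of_ord i).+1 | i <- enum kernel_pos]) l.

(* The m-th smallest kernel entry, at position i_(rho^-1(m)), in the           *)
(* convention that counts from 1; the value at m = 0 is 0.                     *)
Definition kernel_value (rho : 'S_#|kernel_pos|) (m : nat) : nat :=
  nth 0 (0 :: [seq (nat_of_ord (p (enum_val ((rho^-1)%g a)))).+1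
              | a <- enum 'I_#|kernel_pos|]) m.

(* For m : 'I_s and l : 'I_s.+1 this is the cell C_(m.+1)(l.+1), as a set of   *)
(* entries.                                                                    *)
Definition cell (rho : 'S_#|kernel_pos|)
    (m : 'I_#|kernel_pos|) (l : 'I_#|kernel_pos|.+1) : {set 'I_n.+1} :=
  [set p j | j : 'I_n.+1 &
     (kernel_bound l < j.+1 < kernel_bound l.+1)%N &&
     (kernel_value rho m < (p j).+1 < kernel_value rho m.+1)%N].

End PatternGraph.

(* The word rho(1), ..., rho(l-1), m - 1/2, rho(l), ..., rho(s), for the       *)
(* integers m.+1 and l.+1 represented by m and l.                              *)
Definition inserted s (rho : 'S_s) (m : 'I_s) (l : 'I_s.+1) (a : 'I_s.+1) : rat :=
  if unlift l a is Some b then ((rho b).+1%:R)%R else (m.+1%:R - 1 / 2%:R)%R.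

Definition infeasible s (rho : 'S_s) (m : 'I_s) (l : 'I_s.+1) : bool :=
  [exists i, exists j, exists k,
     occ132 (inserted rho m l) i j k && (l \in [:: i; j; k])].

Definition feasible s (rho : 'S_s) (m : 'I_s) (l : 'I_s.+1) : bool :=
  ~~ infeasible rho m l.

(* Main.v *)
(** The key point: if [o] and [o'] are occurrences of 132 in different
    components of the graph, then the entries of [o'] either all separate the entries of
    [o] (by position or by value) or none of them does. The maximal entry does
    not separate any occurrence outside its component, so by connectedness no
    kernel entry does, and the entries of such an occurrence lie in one cell.
    That cell is feasible, as an occurrence created by inserting an entry into
    it would connect the entry to the kernel. *)
Require Import Defs.
From mathcomp Require Import all_boot all_order all_fingroup all_algebra.
From mathcomp Require Import zify lra.

Set Implicit Arguments.
Unset Strict Implicit.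
Unset Printing Implicit Defensive.

Import Order.TTheory GRing.Theory Num.Theory.

(** Cardinalities decide: if [b] lies in [A], so do the [b.+1] indices up to [b]; otherwise [A] fits
    among the [b] indices below it. *)
Lemma down_closed_mem s (A : {set 'I_s}) :
  (forall b c : 'I_s, c <= b -> b \in A -> c \in A) ->
  forall b : 'I_s, (b \in A) = (b < #|A|).
Proof.
move=> downA b.
have card_lt k : k <= s -> #|[set c : 'I_s | c < k]| = k.
  move=> le_ks; rewrite cardsE -sum1_card -(big_ord_widen s (fun=> 1) le_ks).
  by rewrite sum1_card card_ord.
apply/idP/idP => [bA | ].
  rewrite -(card_lt b.+1) //; apply/subset_leq_card/subsetP => c.
  by rewrite inE ltnS => /downA; apply.
apply: contraLR => bNA; rewrite -leqNgt -[leqRHS](card_lt b) ?(ltnW (ltn_ord b)) //.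
apply/subset_leq_card/subsetP => c cA; rewrite inE ltnNge.
by apply: contra bNA => /downA; apply.
Qed.

(** * Ranks in an increasing sequence *)

Section Rank.
Variables (s : nat) (h : 'I_s -> nat).
Hypothesis h_mono : forall a b : 'I_s, (h a < h b) = (a < b).

(** For increasing [h], this is the index of the gap into which [x] falls. *)
Definition rank x := #|[set a | h a < x]|.

Lemma lt_rank x (a : 'I_s) : (a < rank x) = (h a < x).
Proof.
rewrite -down_closed_mem ?inE // => b c le_cb; rewrite !inE.
by apply: leq_ltn_trans; rewrite leqNgt h_mono -leqNgt.
Qed.

Lemma rank_max x : rank x <= s.
Proof. by rewrite -[leqRHS]card_ord max_card. Qed.

Lemma nth_rank d x : x.+1 < d -> (forall a, h a != x) ->
  nth d (0 :: [seq (h a).+1 | a <- enum 'I_s]) (rank x) < x.+1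
    < nth d (0 :: [seq (h a).+1 | a <- enum 'I_s]) (rank x).+1.
Proof.
move=> lt_xd h_neq.
have nth_h (a : 'I_s) : nth d [seq (h a).+1 | a <- enum 'I_s] a = (h a).+1.
  by rewrite (nth_map a) ?size_enum_ord ?nth_ord_enum.
apply/andP; split => /=.
  (* Below the first term the lower bound is the leading 0; otherwise it comes from the last term
     below [x]. *)
  case def_r: (rank x) (rank_max x) => [|r] //= lt_rs.
  by rewrite (nth_h (Ordinal lt_rs)) ltnS -lt_rank def_r /=.
have [lt_rs | le_sr] := ltnP (rank x) s.
  rewrite (nth_h (Ordinal lt_rs)) ltnS ltn_neqAle eq_sym h_neq /=.
  by rewrite leqNgt -lt_rank /= ltnn.
(* Past the last term, the default [d] serves as upper bound. *)
by rewrite nth_default // size_map size_enum_ord.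
Qed.

End Rank.

(** These are the position sets of unions of components, described without paths in the graph. *)
Definition closed132 N (p : 'S_N) (A : {set 'I_N}) := forall i j k,
  occ132 p i j k -> (i \in A = (j \in A)) * (i \in A = (k \in A)).

(** * Entries separating an occurrence *)

Section Separation.
Variables (N : nat) (p : 'S_N) (K : {set 'I_N}).
Hypothesis closedK : closed132 p K.

(** In an occurrence, [i] and [k] are the outer positions, [p i] and [p j] the extreme values. *)
Definition separates (i j k q : 'I_N) : bool :=
  (i < q < k) || (p i < p q < p j).

Variables i j k : 'I_N.
Hypotheses (occ_ijk : occ132 p i j k) (iNK : i \notin K).

Let jNK : j \notin K. Proof. by rewrite -(closedK occ_ijk).1. Qed.
Let kNK : k \notin K. Proof. by rewrite -(closedK occ_ijk).2. Qed.

Lemma mem_notin_neq q r : q \in K -> r \notin K ->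
  (q != r :> nat) && (p q != p r :> nat).
Proof.
move=> qK rNK; have neq_qr : q != r by apply: contraNneq rNK => <-.
by rewrite !(inj_eq val_inj) (inj_eq perm_inj) neq_qr.
Qed.

Lemma occ132E x y z :
  occ132 p x y z = [&& x < y, y < z, p x < p z & p z < p y].
Proof. by []. Qed.

(* The five cells around an occurrence whose insertion creates no occurrence
   sharing an entry with it; the first two are the separating ones. *)
Lemma outer_regions q : q \in K ->
  [|| (q < i) && (p k < p q < p j), (j < q < k) && (p q < p i),
      (q < i) && (p j < p q), (k < q) && (p q < p i) | (k < q) && (p j < p q)].
Proof.
move=> qK.
have /andP[qi pqi] := mem_notin_neq qK iNK.
have /andP[qj pqj] := mem_notin_neq qK jNK.
have /andP[qk pqk] := mem_notin_neq qK kNK.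
have qjk : occ132 p q j k = false.
  by apply: contraNF jNK => /closedK[<- _].
have iqk : occ132 p i q k = false.
  by apply: contraNF iNK => /closedK[-> _].
have ijq : occ132 p i j q = false.
  by apply: contraNF iNK => /closedK[_ ->].
move: occ_ijk qjk iqk ijq; rewrite !occ132E => oijk qjk iqk ijq.
by lia.
Qed.

Lemma separates_closed a b c : occ132 p a b c -> a \in K ->
  (separates i j k a = separates i j k b)
  * (separates i j k a = separates i j k c).
Proof.
move=> occ_abc aK; have [bK cK] := closedK occ_abc.
rewrite aK in bK cK.
(* Excluding these three mixed triples rules out every choice of cells for
   [a], [b], [c] in which separating and non-separating entries coexist. *)
have abj : occ132 p a b j = false.
  by apply: contraNF jNK => /closedK[_ <-].
have akc : occ132 p a k c = false.
  by apply: contraNF kNK => /closedK[<- _].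
have ibc : occ132 p i b c = false.
  by apply: contraNF iNK => /closedK[-> _]; rewrite -bK.
move: (outer_regions aK) (outer_regions (esym bK)) (outer_regions (esym cK)).
move: occ_abc occ_ijk abj akc ibc; rewrite !occ132E /separates.
move: (p i : nat) (p j : nat) (p k : nat) (i : nat) (j : nat) (k : nat).
move: (p a : nat) (p b : nat) (p c : nat) (a : nat) (b : nat) (c : nat).
move=> {aK bK cK}.
move=> pa pb pc {}a {}b {}c pi pj pk i' j' k'.
move=> /and4P[? ? ? ?] /and4P[? ? ? ?] ? ? ?.
(* Five cells for each of [a], [b], [c] give 125 cases of linear arithmetic. *)
by case/or4P=> [|||/orP[]] ?; case/or4P=> [|||/orP[]] ?;
   case/or4P=> [|||/orP[]] ?; solve [exfalso; lia | split; lia].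
Qed.

End Separation.

Lemma enum_val_mono n (A : {set 'I_n}) (a b : 'I_#|A|) :
  (enum_val a < enum_val b) = (a < b).
Proof.
have lt_enum_val (c d : 'I_#|A|) : c < d -> enum_val c < enum_val d.
  move=> lt_cd; have x0 := enum_val c.
  have ltn_sorted : sorted (relpre val ltn) (enum A).
    rewrite /enum_mem -enumT sorted_filter //.
      by move=> ? ? ?; apply: ltn_trans.
    by rewrite -sorted_map val_enum_ord iota_ltn_sorted.
  rewrite !(enum_val_nth x0).
  apply: (sorted_ltn_nth _ x0 ltn_sorted) => //; last 2 first.
  - by rewrite inE -cardE.
  - by rewrite inE -cardE.
  by move=> ? ? ?; apply: ltn_trans.
case: (ltngtP a b) => [/lt_enum_val -> // | /lt_enum_val | /val_inj ->].
  by move=> lt_ba; apply/negbTE; rewrite -leqNgt ltnW.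
by rewrite ltnn.
Qed.

(** * Components and the kernel *)

Section Graph.
Variables (n : nat) (p : 'S_n.+1).
Local Notation K := (kernel_pos p).

Lemma connect_adj_sym : connect_sym (@adj n p).
Proof. by apply: sym_connect_sym => -[?|?] [?|?]. Qed.

Lemma connect_adj_equiv :
  {in [set: vertex p] & &, equivalence_rel (connect (@adj n p))}.
Proof.
move=> x y z _ _ _; split=> [|xy]; first exact: connect0.
exact: same_connect connect_adj_sym _ _ xy z.
Qed.

Lemma mem_component x y :
  (y \in pblock (components p) x) = connect (@adj n p) x y.
Proof. exact: (pblock_equivalence_partition connect_adj_equiv). Qed.

Lemma component_pblock G x :
  G \in components p -> x \in G -> G = pblock (components p) x.
Proof.
move=> GP xG; symmetry; apply: def_pblock GP xG.
by case/and3P: (equivalence_partitionP connect_adj_equiv).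
Qed.

(** Every edge joins an occurrence to one of its entries, so [A] extends to a vertex set closed
    under adjacency, an occurrence being classified by its first position. *)
Lemma connect_closed132 A i j : closed132 p A ->
  connect (@adj n p) (inl (p i)) (inl (p j)) -> (i \in A) = (j \in A).
Proof.
move=> clA.
pose a := [pred x : vertex p |
  match x with inl v => (p^-1)%g v \in A | inr t => (val t).1.1 \in A end].
have entryE v t : occ132 p t.1.1 t.1.2 t.2 -> entry_in p v t ->
    ((p^-1)%g v \in A) = (t.1.1 \in A).
  move=> /clA[eq12 eq13]; rewrite /entry_in !inE.
  by case/or3P=> /eqP->; rewrite permK.
have cla : closed (@adj n p) a.
  move=> [v|[t ot]] [w|[u ou]] //= vt; rewrite !inE /=; first exact: entryE vt.
  by symmetry; apply: entryE vt.
by move/(closed_connect cla); rewrite !inE /= !permK.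
Qed.

Lemma connect_occ132 i j k : occ132 p i j k ->
  connect (@adj n p) (inl (p i)) (inl (p j))
  /\ connect (@adj n p) (inl (p i)) (inl (p k)).
Proof.
move=> oijk; pose t : vertex p := inr (Sub (i, j, k) oijk).
have edge q : q \in [:: i; j; k] -> adj (inl (p q)) t && adj t (inl (p q)).
  by rewrite /adj /= andbb /entry_in !inE /= !(inj_eq perm_inj).
have it : connect (@adj n p) (inl (p i)) t.
  by apply: connect1; have /andP[] := edge i (mem_head _ _).
split; apply: connect_trans it (connect1 _).
  have /andP[] // : adj (inl (p j)) t && adj t (inl (p j)).
    by rewrite edge // !inE eqxx orbT.
have /andP[] // : adj (inl (p k)) t && adj t (inl (p k)).
  by rewrite edge // !inE eqxx !orbT.
Qed.

Lemma mem_kernel i :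
  (i \in K) = connect (@adj n p) (inl ord_max) (inl (p i)).
Proof. by rewrite inE mem_component. Qed.

Lemma kernel_closed : closed132 p K.
Proof.
move=> i j k /connect_occ132[ij ik]; rewrite !mem_kernel.
by rewrite (same_connect_r connect_adj_sym ij)
  -(same_connect_r connect_adj_sym ik)
  (same_connect_r connect_adj_sym ij).
Qed.

Definition top_pos := (p^-1)%g ord_max.

Lemma top_kernel : top_pos \in K.
Proof. by rewrite mem_kernel permKV connect0. Qed.

(** The non-separating kernel positions form a closed set containing [top_pos], and a path in the
    graph carries membership from there to [q]. *)
Lemma kernel_not_separates i j k q : occ132 p i j k -> i \notin K ->
  q \in K -> ~~ separates p i j k q.
Proof.
move=> oijk iNK qK; pose A := [set r in K | ~~ separates p i j k r].
have memA r : (r \in A) = (r \in K) && ~~ separates p i j k r by apply: in_set.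
suff: q \in A by rewrite memA => /andP[].
have clA : closed132 p A.
  move=> a b c oabc; rewrite !memA.
  have [<- <-] := kernel_closed oabc.
  case: (boolP (a \in K)) => //= aK.
  by have [<- <-] := separates_closed kernel_closed oijk iNK oabc aK.
rewrite -(@connect_closed132 A top_pos) //; last by rewrite permKV -mem_kernel.
have le_top r : p r <= (ord_max : 'I_n.+1) by apply: leq_ord.
have lt_top r : r \notin K -> p r < p top_pos.
  rewrite permKV ltn_neqAle le_top andbT => rNK.
  by apply: contraNneq rNK => /val_inj pr; rewrite mem_kernel pr connect0.
have kNK : k \notin K by rewrite -(kernel_closed oijk).2.
(* Standing between [i] and [k], the maximal entry would form an occurrence with them and draw [i]
   into the kernel; by value, nothing exceeds it. *)
rewrite memA top_kernel /separates negb_or /=; apply/andP; split.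
  apply: contra iNK => /andP[lt_it lt_tk].
  have occ_itk : occ132 p i top_pos k.
    by rewrite occ132E lt_it lt_tk lt_top // andbT; case/and4P: oijk.
  by rewrite (kernel_closed occ_itk).1 top_kernel.
by rewrite negb_and orbC -leqNgt permKV le_top.
Qed.

End Graph.

(** Brings the positions in [kernel_bound] into the form required by [nth_rank]. *)
Lemma enum_image_val n (A : {set 'I_n}) :
  enum A = [seq enum_val a | a <- enum 'I_#|A|].
Proof.
case: (set_0Vmem A) => [A0 | [x0 _]].
  have [s1 s2] : size (enum A) = 0 /\ size (enum 'I_#|A|) = 0.
    by rewrite size_enum_ord -cardE A0 cards0.
  by rewrite (size0nil s1) (size0nil s2).
apply: (@eq_from_nth _ x0) => [|i].
  by rewrite size_map size_enum_ord cardE.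
rewrite -cardE => ltiA.
rewrite (nth_map (Ordinal ltiA)) ?size_enum_ord //.
by rewrite (nth_ord_enum _ (Ordinal ltiA)) (enum_val_nth x0).
Qed.

Lemma eq_rank s (h : 'I_s -> nat) x y :
  (forall a, (h a < x) = (h a < y)) -> rank h x = rank h y.
Proof. by move=> eq_h; apply: eq_card => a; rewrite !inE. Qed.

(** * The cell of an entry outside the kernel *)

Section Cells.
Variables (n : nat) (p : 'S_n.+1) (rho : 'S_#|kernel_pos p|).
Hypothesis rho_shape : is_kernel_shape rho.
Local Notation K := (kernel_pos p).
Local Notation s := #|K|.

Definition kernel_pos_at (a : 'I_s) : nat := enum_val a.
Definition kernel_val_at (a : 'I_s) : nat := p (enum_val ((rho^-1)%g a)).

Lemma kernel_pos_at_mono a b : (kernel_pos_at a < kernel_pos_at b) = (a < b).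
Proof. exact: enum_val_mono. Qed.

Lemma kernel_val_at_mono a b : (kernel_val_at a < kernel_val_at b) = (a < b).
Proof. by rewrite -rho_shape !permKV. Qed.

(** For [q] outside the kernel, [pos_rank] and [val_rank] are the column and row of its cell,
    counted from 0. *)
Definition pos_rank (q : 'I_n.+1) := rank kernel_pos_at q.
Definition val_rank (q : 'I_n.+1) := rank kernel_val_at (p q).

Lemma lt_pos_rank q (b : 'I_s) : (b < pos_rank q) = (enum_val b < q).
Proof. exact: (lt_rank kernel_pos_at_mono). Qed.

Lemma lt_val_rank q (b : 'I_s) : (rho b < val_rank q) = (p (enum_val b) < p q).
Proof. by rewrite (lt_rank kernel_val_at_mono) /kernel_val_at permK. Qed.

(** The maximal entry is in the kernel, so no entry lies above all kernel values; hence [s] rows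
    suffice. *)
Lemma val_rank_lt q : q \notin K -> val_rank q < s.
Proof.
move=> qNK; rewrite ltnNge; apply/negP => le_s.
pose a := enum_rank_in (top_kernel p) (top_pos p).
have := leq_trans (ltn_ord (rho a)) le_s.
rewrite lt_val_rank enum_rankK_in ?top_kernel // permKV.
by rewrite ltnNge leq_ord.
Qed.

(** No kernel entry separates the occurrence, so each compares alike with all three entries, in
    position and in value. *)
Lemma ranks_occ132 i j k : occ132 p i j k -> i \notin K ->
  [/\ pos_rank i = pos_rank j, pos_rank i = pos_rank k,
      val_rank i = val_rank j & val_rank i = val_rank k].
Proof.
move=> oijk iNK; have [ij ik] := kernel_closed oijk.
have jNK : j \notin K by rewrite -ij.
have kNK : k \notin K by rewrite -ik.
have outside (a : 'I_s) :
  [/\ (enum_val a < i) = (enum_val a < j), (enum_val a < i) = (enum_val a < k),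
      (p (enum_val a) < p i) = (p (enum_val a) < p j)
    & (p (enum_val a) < p i) = (p (enum_val a) < p k)].
  have aK := enum_valP a; move: (enum_val a) aK => q qK.
  have := kernel_not_separates oijk iNK qK.
  have := mem_notin_neq p qK iNK; have := mem_notin_neq p qK jNK.
  have := mem_notin_neq p qK kNK; move: oijk; rewrite occ132E /separates.
  by clear; split; lia.
by split; apply: eq_rank => a;
  [have [] := outside a | have [] := outside a |
   have [] := outside ((rho^-1)%g a) | have [] := outside ((rho^-1)%g a)].
Qed.

Definition rank_class l m :=
  [set q | [&& q \notin K, pos_rank q == l & val_rank q == m]].

Lemma mem_rank_class l m q : (q \in rank_class l m) =
  [&& q \notin K, pos_rank q == l & val_rank q == m].
Proof. exact: in_set. Qed.

Lemma rank_class_closed l m : closed132 p (rank_class l m).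
Proof.
move=> i j k oijk; rewrite !mem_rank_class.
have [<- <-] := kernel_closed oijk.
by have [// | iNK] := boolP (i \in K); have [<- <- <- <-] := ranks_occ132 oijk iNK.
Qed.

Lemma mem_cell q (m : 'I_s) (l : 'I_s.+1) : q \notin K ->
  pos_rank q = l -> val_rank q = m -> p q \in cell rho m l.
Proof.
move=> qNK eq_l eq_m; apply/imsetP; exists q => //; rewrite inE.
have neq_q r : r \in K -> (r != q :> nat) && (p r != p q :> nat).
  by move=> rK; apply: (mem_notin_neq p rK).
apply/andP; split.
  rewrite /kernel_bound enum_image_val -map_comp -eq_l.
  apply: (nth_rank kernel_pos_at_mono) => [|a]; first by rewrite ltnS ltn_ord.
  by have /andP[] := neq_q _ (enum_valP a).
(* As [m] is below [s], both indices are in range, and the default 0 may be replaced by one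
   exceeding all values. *)
rewrite /kernel_value !(set_nth_default n.+2) /=
        ?size_map -?enumT ?size_enum_ord ?ltnS ?(ltnW (ltn_ord m)) //.
- rewrite -eq_m; apply: (nth_rank kernel_val_at_mono) => [|a].
    by rewrite ltnS ltn_ord.
  by have /andP[] := neq_q _ (enum_valP ((rho^-1)%g a)).
Qed.

(** Sending the inserted letter to [q] and the others to the kernel embeds the word into [p]. An
    occurrence through the inserted letter would become one joining [q] to the kernel. *)
Lemma feasible_rank q (m : 'I_s) (l : 'I_s.+1) : q \notin K ->
  pos_rank q = l -> val_rank q = m -> feasible rho m l.
Proof.
move=> qNK eq_l eq_m.
pose g a := if unlift l a is Some b then enum_val b else q.
have g_pos (a b : 'I_s.+1) : a < b -> g a < g b.
  rewrite /g; case: unliftP => [a' ->|->]; case: unliftP => [b' ->|->] //=.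
  - by rewrite enum_val_mono !ltnNge leq_bump2.
  (* [bump] shifts the letters from index [l] on, and exactly the first [l] kernel positions precede
     [q]. *)
  - by rewrite -lt_pos_rank eq_l /bump; case: leqP => /=; lia.
  - have /andP[neq _] := mem_notin_neq p (enum_valP b') qNK.
    by have := lt_pos_rank q b'; rewrite eq_l /bump; case: leqP => /=; lia.
  - by rewrite ltnn.
have g_val a b :
    (inserted rho m l a < inserted rho m l b)%O -> p (g a) < p (g b).
  rewrite /g /inserted; case: unliftP => [a' _|_]; case: unliftP => [b' _|_].
  - by rewrite ltr_nat ltnS rho_shape.
  (* The letters compared are [rho a' + 1] and [m + 1/2]; the first is smaller exactly when
     [rho a' < m]. *)
  - rewrite -lt_val_rank eq_m; apply: contraTT; rewrite -leqNgt -ltnS.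
    by rewrite -(ler_nat rat) => le_ma; rewrite -leNgt; lra.
  - have /andP[_ neq] := mem_notin_neq p (enum_valP b') qNK.
    move=> lt_mb; rewrite ltn_neqAle eq_sym neq leqNgt -lt_val_rank eq_m.
    apply: contraTN lt_mb; rewrite -ltnS -(ler_nat rat) -(natr1 (rho b').+1) -leNgt.
    by lra.
  - by rewrite ltxx.
have gK a : a != l -> g a \in K.
  by rewrite eq_sym => /unlift_some[b _ gb]; rewrite /g gb enum_valP.
have gl : g l \notin K by rewrite /g unlift_none.
apply/existsP => -[i /existsP[j /existsP[k /andP[/and4P[ij jk fik fkj] l_ijk]]]].
have occ_g : occ132 p (g i) (g j) (g k).
  by rewrite occ132E !g_pos ?g_val.
have [eq_ij eq_ik] := kernel_closed occ_g.
have ltn_neq (a b : 'I_s.+1) : a < b -> a != b.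
  by move=> lt_ab; apply: contraTneq lt_ab => ->; rewrite ltnn.
move: l_ijk; rewrite !inE => /or3P[] /eqP eq_lx.
- by move: gl; rewrite eq_lx eq_ij gK // eq_lx eq_sym ltn_neq.
- by move: gl; rewrite eq_lx -eq_ij gK // eq_lx ltn_neq.
- by move: gl; rewrite eq_lx -eq_ik gK // eq_lx ltn_neq // (ltn_trans ij).
Qed.

End Cells.

Theorem theorem2 (n : nat) (p : 'S_n.+1) (rho : 'S_#|kernel_pos p|)
    (hrho : is_kernel_shape rho)
    (G : {set vertex p}) (hG : G \in components p) (hne : G != top_component p) :
  exists (m : 'I_#|kernel_pos p|) (l : 'I_#|kernel_pos p|.+1),
    feasible rho m l /\
    (forall v : 'I_n.+1, inl v \in G -> v \in cell rho m l).
Proof.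
(* A component is nonempty, and an occurrence is adjacent to its first entry. The cell sought is
   that of [q]. *)
have [q qG] : exists q, inl (p q) \in G.
  have [x xG] : exists x, x \in G.
    apply/set0Pn; apply: contraTneq hG => ->.
    by case/and3P: (equivalence_partitionP (@connect_adj_equiv n p)).
  case: x xG => [v vG | t tG]; first by exists ((p^-1)%g v); rewrite permKV.
  exists (val t).1.1; rewrite (component_pblock hG tG) mem_component.
  by apply: connect1; rewrite /adj /entry_in mem_head.
have qNK : q \notin kernel_pos p.
  rewrite inE; apply: contra hne => qtop.
  rewrite (component_pblock hG qG) eq_sym; apply/eqP/component_pblock => //.
  apply: pblock_mem.
  by rewrite (cover_partition (equivalence_partitionP (@connect_adj_equiv n p))).
have lt_m := val_rank_lt hrho qNK.
have lt_l : pos_rank p q < #|kernel_pos p|.+1 by apply: rank_max.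
exists (Ordinal lt_m), (Ordinal lt_l); split.
  exact: feasible_rank qNK _ _.
move=> v; rewrite -[v](permKV p); move: ((p^-1)%g v) => r rG.
have qr : connect (@adj n p) (inl (p q)) (inl (p r)).
  by rewrite -mem_component -(component_pblock hG qG).
(* The rank class of [q] is closed, so it contains the position of every entry connected to
   [p q]. *)
have := connect_closed132 (rank_class_closed rho (pos_rank p q) (val_rank rho q)) qr.
rewrite !mem_rank_class qNK !eqxx => /esym/and3P[rNK /eqP eq_l /eqP eq_m].
exact: mem_cell.
Qed.
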